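(* Fix integers $r>0$ and $a,b$ with $\gcd(a,b)=1$ and $ab>0$. For every integer $n>rab$ there is a bijection $B^r_{a,b;n}\to B^r_{a,b;n+ab}$ that preserves the Betti statistic $\beta$.
   Context: Partitions are identified with Young diagrams: finite sets $\lambda\subset\mathbb{Z}_{\ge0}^2$ of boxes $(i,j)$ such that $(i,j)\in\lambda$ implies $(i',j')\in\lambda$ for $0\le i'\le i$, $0\le j'\le j$. For $j\ge0$ let $l(j)=\#\{i:(i,j)\in\lambda\}$ and for $i\ge0$ let $c(i)=\#\{j:(i,j)\in\lambda\}$. Box $(i,j)$ has $(a,b;n)$-color $ai+bj\bmod n$. $\lambda$ is $(a,b;n)$-balanced if each residue class mod $n$ is the color of exactly $r$ boxes; $B^r_{a,b;n}$ denotes the set of $(a,b;n)$-balanced partitions of $rn$. An arrow from $(l,s)$ to $(i,j)$ is invariant if $a(l-i)+b(s-j)\equiv 0\pmod n$. For $(i,j)\in\lambda$, $d_{i,j}$ is the arrow from $(l(j),j)$ to $(i,c(i)-1)$ and $u_{i,j}$ the arrow from $(i,c(i))$ to $(l(j)-1,j)$. The Betti statistic of $\lambda\in B^r_{a,b;n}$ (computed with modulus $n$) is $\beta(\lambda)=\#\{(i,j)\in\lambda:d_{i,j}\text{ invariant}\}+\#\{(i,j)\in\lambda:u_{i,j}\text{ invariant and } i=l(j)-1\}$. *)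

(* Defs.v *)
From HB Require Import structures.
From mathcomp Require Import all_boot all_order all_algebra finmap.
Set Implicit Arguments. Unset Strict Implicit. Unset Printing Implicit Defensive.
Import Order.TTheory GRing.Theory Num.Theory.

Local Open Scope fset_scope.
Local Open Scope ring_scope.

Definition young (la : {fset (nat * nat)}) : Prop :=
  forall (i j i' j' : nat), (i, j) \in la -> (i' <= i)%N -> (j' <= j)%N ->
    (i', j') \in la.

Definition lrow (la : {fset (nat * nat)}) (j : nat) : nat :=
  #|` [fset x in la | x.2 == j] |.

Definition ccol (la : {fset (nat * nat)}) (i : nat) : nat :=
  #|` [fset x in la | x.1 == i] |.

Definition color (a b : int) (n : nat) (x : nat * nat) : int :=
  ((a * (x.1)%:Z + b * (x.2)%:Z) %% (n%:Z))%Z.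

Definition balanced (r : nat) (a b : int) (n : nat) (la : {fset (nat * nat)}) : Prop :=
  forall k : nat, (k < n)%N -> #|` [fset x in la | color a b n x == k%:Z] | = r.

Definition Bset (r : nat) (a b : int) (n : nat) (la : {fset (nat * nat)}) : Prop :=
  young la /\ #|` la| = (r * n)%N /\ balanced r a b n la.

(* the arrow from (l,s) to (i,j) is invariant: a(l-i)+b(s-j) = 0 mod n *)
Definition invariant (a b : int) (n : nat) (l s i j : int) : bool :=
  ((a * (l - i) + b * (s - j)) %% (n%:Z) == 0)%Z.

Definition d_inv (a b : int) (n : nat) (la : {fset (nat * nat)}) (x : nat * nat) : bool :=
  invariant a b n (lrow la x.2)%:Z (x.2)%:Z (x.1)%:Z ((ccol la x.1)%:Z - 1).

Definition u_inv (a b : int) (n : nat) (la : {fset (nat * nat)}) (x : nat * nat) : bool :=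
  invariant a b n (x.1)%:Z (ccol la x.1)%:Z ((lrow la x.2)%:Z - 1) (x.2)%:Z.

Definition betti (a b : int) (n : nat) (la : {fset (nat * nat)}) : nat :=
  (#|` [fset x in la | d_inv a b n la x] |
   + #|` [fset x in la | u_inv a b n la x && (((x.1)%:Z : int) == (lrow la x.2)%:Z - 1)%R] |)%N.

(* Main.v *)
Require Import Defs.
From HB Require Import structures.
From mathcomp Require Import all_boot all_order all_algebra finmap zify.
Import Order.TTheory GRing.Theory Num.Theory.
Set Implicit Arguments. Unset Strict Implicit. Unset Printing Implicit Defensive.
Local Open Scope fset_scope.
Local Open Scope nat_scope.

(* Let a, b > 0 and s = r a b < n (negating both a and b changes nothing).  Give
   the corner (x,y) of the grid the weight a x + b y, and read the boundary of a
   balanced diagram as a walk whose steps add a or subtract b.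
   The line of weight s carries r+1 boxes, which cannot all lie in the diagram,
   so there is an addable box (p,q) of weight at most s.  The walk comes down to
   weight at most s and goes up again, and balancedness leaves no room for extra
   crossings: modulo n, the columns left of p and the rows below q have their
   boundary edges inside the residues 0..s.  Hence between the residues s and n
   the two arms of the diagram (columns left of p, rows below q) are straight,
   and at each level k they can be lengthened or shortened so that the weights
   k n + c become k m + c, for any m > s congruent to n modulo ab.  This is
   invertible.  Residue classes up to s keep their number of boxes; above s the
   class sizes M satisfy M(k) + M(k-a-b) = M(k-a) + M(k-b), as no edge of the
   arms ends there.  Finally a pair counted by the Betti statistic is an edge of
   a column and an edge of a row meeting in a residue at most s, and those
   coincidences are preserved. *)

(** * Changing the modulus while keeping residues *)

Definition theta (n m v : nat) : nat := v %/ n * m + v %% n.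

Lemma theta_div n m v : v %% n < m -> theta n m v %/ m = v %/ n.
Proof. by move=> h; rewrite /theta divnMDl ?(leq_ltn_trans (leq0n _) h) // (divn_small h) addn0. Qed.

Lemma theta_mod n m v : v %% n < m -> theta n m v %% m = v %% n.
Proof. by move=> h; rewrite /theta modnMDl modn_small. Qed.

Lemma theta_small n m v : v < n -> theta n m v = v.
Proof. by move=> h; rewrite /theta divn_small // modn_small. Qed.

Lemma theta_large n m v : 0 < n -> n <= v -> m <= theta n m v.
Proof.
move=> n0 h; have : 0 < v %/ n by rewrite divn_gt0.
by rewrite /theta; case: (v %/ n) => // k _; rewrite mulSn -!addnA leq_addr.
Qed.

Lemma thetaK n m v : v %% n < m -> theta m n (theta n m v) = v.
Proof. by move=> h; rewrite {1}/theta theta_div ?theta_mod // -divn_eq. Qed.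

(** Values compare by quotient first and by residue second, and [theta] keeps both while residues
    stay below [m]. The converse direction is the same fact for the inverse [theta m n]. *)
Lemma theta_ltn n m v w :
  v %% n < m -> w %% n < m -> 0 < n -> (theta n m v < theta n m w) = (v < w).
Proof.
move=> hv hw n0.
have lt_impl n1 m1 v1 w1 : w1 %% n1 < m1 -> v1 %% n1 < m1 ->
    v1 < w1 -> theta n1 m1 v1 < theta n1 m1 w1.
  move=> hw1 hv1 hlt; rewrite /theta.
  have := leq_div2r n1 (ltnW hlt); rewrite leq_eqVlt => /orP[/eqP e|lt1].
    by rewrite e ltn_add2l; move: hlt; rewrite {1}(divn_eq v1 n1) {1}(divn_eq w1 n1) e ltn_add2l.
  apply: (@leq_trans (((v1 %/ n1).+1 * m1))); first by rewrite mulSn addnC ltn_add2r.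
  by apply: leq_trans (leq_addr _ _); rewrite leq_mul2r lt1 orbT.
apply/idP/idP; last exact: lt_impl.
move=> h; rewrite -(@thetaK n m v) // -(@thetaK n m w) //.
by apply: lt_impl => //; rewrite theta_mod // ltn_mod.
Qed.

Lemma theta_leq n m v w :
  v %% n < m -> w %% n < m -> 0 < n -> (theta n m v <= theta n m w) = (v <= w).
Proof.
move=> hv hw n0; rewrite leqNgt (theta_ltn hw hv n0); exact: esym (leqNgt v w).
Qed.

Lemma theta_cong n m v d : n = m %[mod d] -> theta n m v = v %[mod d].
Proof.
move=> e; rewrite /theta [in RHS](divn_eq v n); apply/eqP.
by rewrite eqn_modDr -[X in X == _]modnMmr -e modnMmr.
Qed.

Definition reach (b n m u v : nat) : nat := (theta n m v - u) %/ b.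

Lemma reachE b n m u v k : n = m %[mod b] -> v = u + b * k -> u <= theta n m v ->
  u + b * reach b n m u v = theta n m v.
Proof.
move=> e ev hu; rewrite /reach mulnC divnK ?subnKC // -(eqn_mod_dvd _ hu).
by rewrite (theta_cong _ e) ev mulnC addnC modnMDl.
Qed.

Lemma theta_add n m v t : v %% n + t < n -> theta n m (v + t) = theta n m v + t.
Proof.
move=> h; have n0 : 0 < n by apply: leq_ltn_trans h.
rewrite /theta {1 2}(divn_eq v n) -addnA divnMDl // modnMDl.
by rewrite (divn_small h) (modn_small h) addn0 addnA.
Qed.

Lemma modnD_small v k n : v %% n + k < n -> (v + k) %% n = v %% n + k.
Proof. by move=> h; rewrite -modnDml modn_small. Qed.

Lemma eqn_modW d d' n m : d %| d' -> n = m %[mod d'] -> n = m %[mod d].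
Proof. by move=> dd' e; rewrite -(modn_dvdm n dd') -(modn_dvdm m dd') e. Qed.

(* Hermite's identity, at the fraction [t / n]. *)
Lemma sum_divnD n t : 0 < n -> \sum_(k < n) ((k + t) %/ n) = t.
Proof.
move=> n0; elim: t => [|t IH].
  by rewrite big1 // => k _; rewrite addn0 divn_small.
have E u : \sum_(k < n) ((k + u) %/ n) = \sum_(u <= k < u + n) k %/ n.
  rewrite -{2}(add0n u) (addnC u n) big_addn addnK big_mkord.
  by apply: eq_bigr => k _.
move: IH; rewrite !E.
have lt1 : t < t + n by rewrite -[X in X < _]addn0 ltn_add2l.
rewrite (big_ltn lt1) addSn big_nat_recr //= divnDr ?dvdnn // divnn n0.
by move=> e; rewrite addnA (addnC _ (t %/ n)) e addn1.
Qed.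

(** * Residues of the boundary of a balanced diagram *)

(** The mixed difference [f (v+a+b) - f (v+a) - f (v+b) + f v] telescopes along a row with step [a],
    leaving its two ends; terms change sides to avoid subtraction in [nat]. *)
Lemma row_telescope (f : nat -> nat) a b u h :
  \sum_(i < h) (f (a * i + u + (a + b)) + f (a * i + u))
    + (f (a * h + u) + f (u + b)) =
  \sum_(i < h) (f (a * i + u + a) + f (a * i + u + b))
    + (f (a * h + u + b) + f u).
Proof.
elim: h => [|h IH]; first by rewrite !big_ord0 muln0 !add0n addnC.
rewrite !big_ord_recr /=.
have -> : a * h.+1 + u = a * h + u + a by rewrite mulnS; lia.
move: IH; rewrite -!addnA.
move: (f _) (f _) (f _) (f _) (f _) (f _) (\sum_(i < h) _) (\sum_(i < h) _).
by move=> *; lia.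
Qed.

Section Tameness.
Variables (a b n r s X q : nat) (l : nat -> nat).
Hypothesis b_gt0 : 0 < b.
Hypothesis ltsn : s < n.
Hypothesis l_anti : forall j, l j.+1 <= l j.
Hypothesis lX : l X = 0.
Hypothesis qX : q <= X.
Hypothesis lq : a * l q + b * q <= s.
Hypothesis bal : forall G : nat -> nat,
  \sum_(j < X) \sum_(i < l j) G ((a * i + b * j) %% n) = r * \sum_(k < n) G k.

Let n_gt0 : 0 < n. Proof. exact: leq_ltn_trans ltsn. Qed.

(** Adding [t] raises the quotient of [v] by [(v %% n + t) %/ n]; by [bal] these raises spread
    evenly over the residues, and Hermite's identity sums them. *)
Lemma sum_boxes_divn t :
  \sum_(j < X) \sum_(i < l j) (a * i + b * j + t) %/ n =
  \sum_(j < X) \sum_(i < l j) (a * i + b * j) %/ n + r * t.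
Proof.
rewrite -[in RHS](sum_divnD t n_gt0).
rewrite -(bal (fun k => (k + t) %/ n)) -big_split.
apply: eq_bigr => j _; rewrite -big_split; apply: eq_bigr => i _ /=.
by rewrite [in LHS](divn_eq (a * i + b * j) n) -addnA divnMDl.
Qed.

(* Summed over the boxes, [f (v+a+b) + f v] and [f (v+a) + f (v+b)] agree by
   [sum_boxes_divn], and along each row the difference telescopes. *)
Lemma sum_row_ends e (f := fun v => (v + e) %/ n) :
  \sum_(j < X) f (a * l j + b * j + b) + f 0 =
  \sum_(j < X) f (a * l j + b * j) + f (b * X).
Proof.
have tel Y : \sum_(j < Y) f (b * j + b) + f 0 = \sum_(j < Y) f (b * j) + f (b * Y).
  elim: Y => [|Y IH]; first by rewrite !big_ord0 muln0.
  by rewrite !big_ord_recr /= addnAC IH mulnS (addnC b).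
have rows : \sum_(j < X) (f (a * l j + b * j) + f (b * j + b)) =
            \sum_(j < X) (f (a * l j + b * j + b) + f (b * j)).
  have box t : \sum_(j < X) \sum_(i < l j) f (a * i + b * j + t) =
    \sum_(j < X) \sum_(i < l j) (a * i + b * j) %/ n + r * (t + e).
    rewrite -sum_boxes_divn; apply: eq_bigr => j _; apply: eq_bigr => i _.
    by rewrite /f addnA.
  have: \sum_(j < X) (\sum_(i < l j) (f (a * i + b * j + (a + b)) + f (a * i + b * j))
      + (f (a * l j + b * j) + f (b * j + b)))
    = \sum_(j < X) (\sum_(i < l j) (f (a * i + b * j + a) + f (a * i + b * j + b))
      + (f (a * l j + b * j + b) + f (b * j))).
    by apply: eq_bigr => j _; apply: row_telescope.
  rewrite [LHS]big_split [RHS]big_split /=.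
  have -> : \sum_(j < X) \sum_(i < l j) (f (a * i + b * j + (a + b)) + f (a * i + b * j))
   = \sum_(j < X) \sum_(i < l j) (f (a * i + b * j + a) + f (a * i + b * j + b)).
    under eq_bigr => j _ do rewrite big_split /=.
    under [RHS]eq_bigr => j _ do rewrite big_split /=.
    have box0 : \sum_(j < X) \sum_(i < l j) f (a * i + b * j) =
        \sum_(j < X) \sum_(i < l j) (a * i + b * j) %/ n + r * (0 + e).
      by rewrite -box; apply: eq_bigr => j _; apply: eq_bigr => i _; rewrite addn0.
    rewrite !big_split /= !box box0 !mulnDr; lia.
  by move/addnI.
move: rows; rewrite !big_split /=; move: (tel X).
by move: (f 0) (f _) (\sum_(i < X) _) (\sum_(i < X) _) (\sum_(i < X) _) (\sum_(i < X) _); lia.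
Qed.

(* The rows from [q] on already use up the total of [sum_row_ends], because the
   boundary weight drops by at most [b] from one row to the next. *)
Lemma sum_bottom_rows e (f := fun v => (v + e) %/ n) : s + e < n ->
  \sum_(j < q) f (a * l j + b * j + b) <= \sum_(j < q) f (a * l j + b * j).
Proof.
move=> he; have f0 v : v <= s -> f v = 0.
  by move=> vs; rewrite /f divn_small //; apply: leq_ltn_trans he; rewrite leq_add2r.
(* The end of row [Y.+1] weighs at most [b] more than that of row [Y], so the shifted term of row
   [Y] pays for it; the end of row [q] costs 0. *)
have top Y : q <= Y -> \sum_(q <= j < Y) f (a * l j + b * j) + f (a * l Y + b * Y)
    <= \sum_(q <= j < Y) f (a * l j + b * j + b).
  elim: Y => [|Y IH]; first by rewrite leqn0 => /eqP q0; rewrite !big_geq ?f0 // -q0.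
  rewrite leq_eqVlt => /orP[/eqP <-|qY]; first by rewrite !big_geq ?f0.
  rewrite !big_nat_recr //=; apply: leq_add; first exact: IH.
  apply: leq_div2r; rewrite leq_add2r mulnS; have := l_anti Y; nia.
have ends : \sum_(j < X) f (a * l j + b * j + b) + f 0 =
    \sum_(j < X) f (a * l j + b * j) + f (b * X) := sum_row_ends e.
have spl (g : nat -> nat) : \sum_(j < X) g j = \sum_(j < q) g j + \sum_(q <= j < X) g j.
  by rewrite -(big_mkord xpredT) -(big_mkord xpredT g) (@big_cat_nat _ _ _ q).
rewrite f0 // addn0 in ends.
move: ends; rewrite (spl (fun j => f (a * l j + b * j + b))) (spl (fun j => f (a * l j + b * j))).
have := top X qX; rewrite lX muln0 add0n.
move: (f _) (\sum_(j < q) _) (\sum_(q <= j < X) _) (\sum_(j < q) _) (\sum_(q <= j < X) _).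
by lia.
Qed.

(** If the edge of row [j] left the residues up to [s], a suitable shift would make it cross a
    multiple of [n]. The other rows cannot compensate, against [sum_bottom_rows]. *)
Lemma rows_tame j : j < q -> (a * l j + b * j) %% n + b <= s.
Proof.
move=> jq; rewrite leqNgt; apply/negP => hc.
pose v := a * l j + b * j; pose c := v %% n.
(* With this shift [v + e] stays below the next multiple of [n] while [v + b + e] reaches it, and
   [s + e < n] because [s < c + b]. If [c + b] exceeds [n], truncation to 0 still has these
   properties. *)
pose e := n - (c + b).
have cn : c < n by rewrite ltn_mod.
have se : s + e < n by rewrite /e -/c in hc *; lia.
have := sum_bottom_rows se; rewrite leqNgt => /negP; apply.
have lt1 : (v + e) %/ n < (v + b + e) %/ n.
  have -> : (v + e) %/ n = v %/ n.
    rewrite {1}(divn_eq v n) -addnA divnMDl // -/c (@divn_small (c + e)) ?addn0 //.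
    by move: hc cn ltsn b_gt0; rewrite /e -/v -/c; lia.
  rewrite {2}(divn_eq v n) -!addnA divnMDl // -/c -[X in X < _]addn0 ltn_add2l.
  by rewrite divn_gt0 // /e; lia.
rewrite (bigD1 (Ordinal jq)) //= [X in _ < X](bigD1 (Ordinal jq)) //= -/v.
rewrite -addSn; apply: leq_add => //.
by apply: leq_sum => i _; rewrite leq_div2r // leq_add2r leq_addr.
Qed.

End Tameness.

(** * Young diagrams as column heights and row lengths *)

Section FsetCounting.
Variable T : choiceType.
Implicit Types A B : {fset T}.

Lemma card_fset_sum A (Q : pred T) : #|` [fset x in A | Q x]| = \sum_(x <- A) Q x.
Proof.
transitivity (\sum_(x <- A | Q x) 1); first by rewrite big_fset_condE sum1_size.
by rewrite big_mkcond; apply: eq_bigr => x _; case: (Q x).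
Qed.

Lemma mem_downset A (f : nat -> T) k : injective f ->
  (forall x, x \in A -> exists i, x = f i) ->
  (forall i j, f i \in A -> j <= i -> f j \in A) -> (f k \in A) = (k < #|` A|).
Proof.
move=> f_inj fA downA.
have cardf m : #|` [fset f i | i in iota 0 m]| = m.
  by rewrite card_imfset //= undup_id ?iota_uniq ?size_iota.
apply/idP/idP => h.
  rewrite -[k.+1]cardf; apply: fsubset_leq_card; apply/fsubsetP => _ /imfsetP[i /= hi ->].
  have {}hi : i \in iota 0 k.+1 := hi.
  by apply: downA h _; move: hi; rewrite mem_iota.
apply: contraLR h => kA; rewrite -leqNgt -[k]cardf.
apply: fsubset_leq_card; apply/fsubsetP => x xA; have [i ex] := fA x xA.
apply/imfsetP; exists i => //=; rewrite mem_iota add0n /= ltnNge.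
by apply: contra kA => ki; apply: (downA i) => //; rewrite -ex.
Qed.

(** An injection given as a relation, so that image boxes can come from existence lemmas. The
    induction removes [x] together with one partner [y]. *)
Lemma leq_card_fset_rel (U : choiceType) (R : T -> U -> Prop) A (B : {fset U}) :
  (forall x, x \in A -> exists2 y, y \in B & R x y) ->
  (forall x x' y, x \in A -> x' \in A -> R x y -> R x' y -> x = x') ->
  #|` A| <= #|` B|.
Proof.
elim/finSet_rect: A B => A IH B RAB Rinj.
have [->|[x xA]] := fset_0Vmem A; first by rewrite cardfs0.
have [y yB Rxy] := RAB x xA.
rewrite (cardfsD1 x) xA (cardfsD1 y B) yB !add1n ltnS; apply: IH.
- by rewrite fproperD1.
- move=> x'; rewrite !inE => /andP[x'x x'A]; have [y' y'B Rxy'] := RAB x' x'A.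
  exists y' => //; rewrite !inE y'B andbT; apply/eqP => yy'; move/eqP: x'x; apply.
  by apply: (Rinj _ _ y) => //; rewrite -yy'.
- by move=> u v w; rewrite !inE => /andP[_ uA] /andP[_ vA]; apply: Rinj.
Qed.

End FsetCounting.

Section Profiles.
Variable la : {fset nat * nat}.
Hypothesis la_young : young la.

Lemma mem_lrow i j : ((i, j) \in la) = (i < lrow la j).
Proof.
rewrite -(@mem_downset _ [fset x in la | x.2 == j] (fun k => (k, j)) i).
- by rewrite !inE eqxx andbT.
- by move=> k k' [].
- by move=> [k j']; rewrite !inE /= => /andP[_ /eqP ->]; exists k.
- by move=> k k'; rewrite !inE !eqxx !andbT => h kk; apply: la_young h _ _.
Qed.

Lemma mem_ccol i j : ((i, j) \in la) = (j < ccol la i).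
Proof.
rewrite -(@mem_downset _ [fset x in la | x.1 == i] (fun k => (i, k)) j).
- by rewrite !inE eqxx andbT.
- by move=> k k' [].
- by move=> [i' k]; rewrite !inE /= => /andP[_ /eqP ->]; exists k.
- by move=> k k'; rewrite !inE !eqxx !andbT => h kk; apply: la_young h _ _.
Qed.

Lemma ccol_bound i : #|` la| <= i -> ccol la i = 0.
Proof.
move=> hi; apply/eqP; rewrite -leqn0 leqNgt -mem_ccol; apply: contraL hi.
rewrite mem_lrow -ltnNge => /leq_trans; apply; apply: fsubset_leq_card.
by apply/fsubsetP => x; rewrite !inE => /andP[].
Qed.

Lemma lrow_bound j : #|` la| <= j -> lrow la j = 0.
Proof.
move=> hj; apply/eqP; rewrite -leqn0 leqNgt -mem_lrow; apply: contraL hj.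
rewrite mem_ccol -ltnNge => /leq_trans; apply; apply: fsubset_leq_card.
by apply/fsubsetP => x; rewrite !inE => /andP[].
Qed.

Lemma sum_cols X (F : nat -> nat -> nat) : #|` la| <= X ->
  \sum_(x <- la) F x.1 x.2 = \sum_(i < X) \sum_(j < ccol la i) F i j.
Proof.
move=> hX.
pose s := [seq (i, j) | i <- iota 0 X, j <- iota 0 (ccol la i)].
have us : uniq s.
  by apply: allpairs_uniq_dep => [|i _|[i j] [i' j'] _ _ /= []->->//]; rewrite iota_uniq.
have ps : perm_eq la s.
  apply: uniq_perm => // -[i j]; apply/idP/allpairsPdep => [h|[i' [j' []]]].
    exists i, j; rewrite !mem_iota /= !add0n -mem_ccol h; split=> //.
    by rewrite ltnNge; apply: contraL h => /(leq_trans hX)/ccol_bound ci; rewrite mem_ccol ci.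
  by rewrite !mem_iota /= !add0n => _ ? [-> ->]; rewrite mem_ccol.
rewrite (perm_big _ ps) /= big_allpairs_dep /= -{1}(subn0 X).
rewrite -/(index_iota 0 X) big_mkord; apply: eq_bigr => i _.
by rewrite -{1}(subn0 (ccol _ _)) -/(index_iota 0 _) big_mkord.
Qed.

Lemma sum_rows X (F : nat -> nat -> nat) : #|` la| <= X ->
  \sum_(x <- la) F x.1 x.2 = \sum_(j < X) \sum_(i < lrow la j) F i j.
Proof.
move=> hX.
have cX i : ccol la i <= X.
  apply: leq_trans hX; apply: fsubset_leq_card.
  by apply/fsubsetP => x; rewrite !inE => /andP[].
have lX j : lrow la j <= X.
  apply: leq_trans hX; apply: fsubset_leq_card.
  by apply/fsubsetP => x; rewrite !inE => /andP[].
rewrite (sum_cols _ hX).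
under eq_bigr => i _ do rewrite (big_ord_widen _ _ (cX i)).
rewrite (exchange_big_dep xpredT) //=; apply: eq_bigr => j _.
rewrite (big_ord_widen _ (fun i => F i j) (lX j)).
by apply: eq_bigl => i; rewrite -mem_ccol mem_lrow.
Qed.

End Profiles.

(** * Pairs of diagrams with arms of different length *)

(* Column [i] contributes the boundary edge from weight [a i + b (c i)] to that
   weight plus [a], row [j] the edge between [b j + a (l j)] and that weight plus
   [b]; the last two fields say that, modulo [n], these edges lie in 0..s. *)
Record tame (a b s n : nat) (c l : nat -> nat) (p q : nat) : Prop := Tame {
  tame_s : s < n;
  tame_a : 0 < a;
  tame_b : 0 < b;
  tame_conj : forall i j, (i < l j) = (j < c i);
  tame_pq : a * p + b * q <= s;
  tame_cp : c p <= q;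
  tame_lq : l q <= p;
  tame_c : forall i, i < p -> q < c i;
  tame_l : forall j, j < q -> p < l j;
  tame_col : forall i, i < p -> (a * i + b * c i) %% n + a <= s;
  tame_row : forall j, j < q -> (b * j + a * l j) %% n + b <= s
}.

(** Both diagrams share the corner [(p, q)]. The notion is symmetric under exchanging the axes and
    under exchanging the moduli, which halves the later arguments. *)
Record stretched (a b s n m : nat) (c l c' l' : nat -> nat) (p q : nat) : Prop := Stretched {
  str_src : tame a b s n c l p q;
  str_tgt : tame a b s m c' l' p q;
  str_mod : n = m %[mod a * b];
  str_col : forall i, i < p -> a * i + b * c' i = theta n m (a * i + b * c i);
  str_row : forall j, j < q -> b * j + a * l' j = theta n m (b * j + a * l j)
}.

Lemma tame_tr a b s n c l p q : tame a b s n c l p q -> tame b a s n l c q p.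
Proof. by case=> *; split=> //; rewrite addnC. Qed.

Lemma stretched_tr a b s n m c l c' l' p q :
  stretched a b s n m c l c' l' p q -> stretched b a s n m l c l' c' q p.
Proof. by case=> /tame_tr t /tame_tr t' e *; split=> //; rewrite mulnC. Qed.

Lemma stretched_sym a b s n m c l c' l' p q :
  stretched a b s n m c l c' l' p q -> stretched a b s m n c' l' c l p q.
Proof.
case=> t t' e hc hl; split=> //.
- move=> i ip; rewrite hc // thetaK //.
  exact: leq_ltn_trans (leq_trans (leq_addr _ _) (tame_col t ip)) (tame_s t').
- move=> j jq; rewrite hl // thetaK //.
  exact: leq_ltn_trans (leq_trans (leq_addr _ _) (tame_row t jq)) (tame_s t').
Qed.

Lemma tame_anti a b s n c l p q : tame a b s n c l p q ->
  forall i i', i <= i' -> c i' <= c i.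
Proof.
move=> t i i' ii'; rewrite leqNgt -(tame_conj t); apply/negP => h.
by move: (leq_ltn_trans ii' h); rewrite (tame_conj t) ltnn.
Qed.

(** * Transport of boundary vertices along [theta] *)

Section Stretched.
Variables (a b s n m : nat) (c l c' l' : nat -> nat) (p q : nat).
Hypothesis S : stretched a b s n m c l c' l' p q.

Let a_gt0 : 0 < a. Proof. exact: tame_a (str_src S). Qed.
Let b_gt0 : 0 < b. Proof. exact: tame_b (str_src S). Qed.
Let s_n : s < n. Proof. exact: tame_s (str_src S). Qed.
Let s_m : s < m. Proof. exact: tame_s (str_tgt S). Qed.
Let n_gt0 : 0 < n. Proof. exact: leq_ltn_trans s_n. Qed.
Let pq_s : a * p + b * q <= s. Proof. exact: tame_pq (str_src S). Qed.

Lemma col_end_residue i : i < p -> (a * i + b * c i) %% n < m.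
Proof.
move=> ip; have := tame_col (str_src S) ip.
by move=> /(leq_trans (leq_addr _ _))/leq_ltn_trans; apply.
Qed.

Lemma col_end_mod i : i < p -> (a * i + b * c' i) %% m = (a * i + b * c i) %% n.
Proof. by move=> ip; rewrite (str_col S ip) theta_mod ?col_end_residue. Qed.

Lemma col_end_add i : i < p -> theta n m (a * i + b * c i + a) = a * i + b * c' i + a.
Proof.
by move=> ip; rewrite (str_col S ip) theta_add // (leq_ltn_trans (tame_col (str_src S) ip)).
Qed.

Lemma mem_theta i j j' : i < p -> (a * i + b * j) %% n < m ->
  a * i + b * j' = theta n m (a * i + b * j) -> (j' < c' i) = (j < c i).
Proof.
move=> ip hr e.
have <- : (a * i + b * j < a * i + b * c i) = (j < c i) by rewrite ltn_add2l ltn_pmul2l.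
have <- : (a * i + b * j' < a * i + b * c' i) = (j' < c' i) by rewrite ltn_add2l ltn_pmul2l.
by rewrite e (str_col S ip) theta_ltn // col_end_residue.
Qed.

(** The vertex moves along its vertical line: weights below [n] are fixed, and larger ones land at
    [m] or more, beyond the weight of [(x, q)]. The new height is an integer because [n = m] modulo
    [b]. *)
Lemma vertex_theta x y : x <= p -> exists2 y', a * x + b * y' = theta n m (a * x + b * y) &
  (q <= y -> q <= y') /\ (q < y -> q < y').
Proof.
move=> xp; have [small|large] := ltnP (a * x + b * y) n.
  by exists y; rewrite ?theta_small.
have big : m <= theta n m (a * x + b * y) by apply: theta_large.
have ap : a * x <= a * p by rewrite leq_mul2l xp orbT.
have e : n = m %[mod b] := eqn_modW (dvdn_mull a (dvdnn b)) (str_mod S).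
have h : a * x <= theta n m (a * x + b * y) by lia.
exists (reach b n m (a * x) (a * x + b * y)); first exact: reachE e erefl h.
have E := reachE e erefl h.
suff : q < reach b n m (a * x) (a * x + b * y) by move=> lt1; split=> // _; apply: ltnW.
rewrite -(ltn_pmul2l b_gt0); lia.
Qed.

(** As [l j <= p], the row end moves vertically by [vertex_theta]. The row found there has the same
    length: it misses column [l j] and meets column [l j - 1], by comparison with the left end of
    the top edge of the former (or [tame_cp] if [l j = p]) and the right end of that of the
    latter. *)
Lemma row_end_theta j : q <= j -> (a * l j + b * j) %% n <= s ->
  exists j', [/\ q <= j', l' j' = l j & a * l j + b * j' = theta n m (a * l j + b * j)].
Proof.
move=> qj hr; have t := str_src S; have t' := str_tgt S.
have lp : l j <= p by apply: leq_trans (tame_anti (tame_tr t) qj) (tame_lq t).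
have [j' e [/(_ qj) qj' _]] := vertex_theta j lp; exists j'; split=> //.
apply/eqP; rewrite eqn_leq; apply/andP; split.
  rewrite leqNgt (tame_conj t'); have [xp|px] := ltnP (l j) p.
    rewrite (mem_theta xp _ e); last by lia.
    by rewrite -(tame_conj t) ltnn.
  have -> : l j = p by apply/eqP; rewrite eqn_leq lp.
  by rewrite -leqNgt (leq_trans (tame_cp t')).
case ex: (l j) lp e hr => [//|x] xp e hr; rewrite (tame_conj t').
have xc : j < c x by rewrite -(tame_conj t) ex.
suff: a * x.+1 + b * j' < a * x + b * c' x + a.
  by rewrite mulnS (addnC a) addnAC ltn_add2r ltn_add2l ltn_pmul2l.
rewrite -col_end_add // e theta_ltn //.
- by rewrite mulnS (addnC a) addnAC ltn_add2r ltn_add2l ltn_pmul2l.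
- by lia.
- rewrite -modnDml modn_small; have := tame_col t xp; lia.
Qed.

Lemma row_start_theta j : q <= j -> (a * l j + b * j.+1) %% n <= s ->
  exists j', [/\ q <= j', l' j' = l j & a * l j + b * j'.+1 = theta n m (a * l j + b * j.+1)].
Proof.
move=> qj hr; have t := str_src S; have t' := str_tgt S.
have lp : l j <= p by apply: leq_trans (tame_anti (tame_tr t) qj) (tame_lq t).
have [[|j'] e [_ ]] := vertex_theta j.+1 lp; rewrite !ltnS => /(_ qj) // qj'.
exists j'; split=> //.
apply/eqP; rewrite eqn_leq; apply/andP; split.
  rewrite leqNgt (tame_conj t'); have [xp|px] := ltnP (l j) p.
    have <- : (a * l j + b * j'.+1 <= a * l j + b * c' (l j)) = (j' < c' (l j)).
      by rewrite leq_add2l leq_pmul2l.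
    rewrite e (str_col S xp) theta_leq ?col_end_residue //; last by lia.
    by rewrite leq_add2l leq_pmul2l // -(tame_conj t) ltnn.
  have -> : l j = p by apply/eqP; rewrite eqn_leq lp.
  by rewrite -leqNgt (leq_trans (tame_cp t')).
case ex: (l j) lp e hr => [//|x] xp e hr; rewrite (tame_conj t').
have xc : j < c x by rewrite -(tame_conj t) ex.
suff: a * x.+1 + b * j'.+1 <= a * x + b * c' x + a.
  by rewrite mulnS (addnC a) addnAC leq_add2r leq_add2l leq_pmul2l.
rewrite -col_end_add // e theta_leq //.
- by rewrite mulnS (addnC a) addnAC leq_add2r leq_add2l leq_pmul2l.
- by lia.
- rewrite -modnDml modn_small; have := tame_col t xp; lia.
Qed.

End Stretched.

(** * Class sizes and the Betti statistic of a stretched pair *)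

Definition weight (a b : nat) (x : nat * nat) : nat := a * x.1 + b * x.2.

(* [d_inv] and [u_inv] (with its side condition), freed of subtractions. *)
Definition dnat (a b n : nat) (c l : nat -> nat) (x : nat * nat) : bool :=
  a * x.1 + b * c x.1 == a * l x.2 + b * x.2 + b %[mod n].

Definition unat (a b n : nat) (c l : nat -> nat) (x : nat * nat) : bool :=
  (l x.2 == x.1.+1) && (a * x.1 + b * c x.1 + a == a * l x.2 + b * x.2 %[mod n]).

Section Counting.
Variables (a b s n m : nat) (c l c' l' : nat -> nat) (p q : nat).
Variables la mu : {fset nat * nat}.
Hypothesis S : stretched a b s n m c l c' l' p q.
Hypothesis mem_la : forall i j, ((i, j) \in la) = (j < c i).
Hypothesis mem_mu : forall i j, ((i, j) \in mu) = (j < c' i).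

Let t := str_src S.
Let t' := str_tgt S.
Let s_n : s < n. Proof. exact: tame_s t. Qed.
Let s_m : s < m. Proof. exact: tame_s t'. Qed.
Let n_gt0 : 0 < n. Proof. exact: leq_ltn_trans s_n. Qed.
Let a_gt0 : 0 < a. Proof. exact: tame_a t. Qed.
Let b_gt0 : 0 < b. Proof. exact: tame_b t. Qed.

Lemma mem_row i j : p <= i -> (i, j) \in la -> j < q.
Proof.
move=> pi; rewrite mem_la => h; apply: leq_trans h _.
exact: leq_trans (tame_anti t pi) (tame_cp t).
Qed.

(** Boxes left of [p] slide along their column, the others along their row. The two kinds land on
    different sides of [p], so this is injective; [stretched_sym] gives the reverse inequality. *)
Lemma class_leq k : k <= s ->
  #|` [fset x in la | weight a b x %% n == k]| <=
  #|` [fset x in mu | weight a b x %% m == k]|.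
Proof.
move=> ks; have km := leq_ltn_trans ks s_m.
pose R (x y : nat * nat) := weight a b y = theta n m (weight a b x) /\
  (x.1 < p /\ y.1 = x.1 \/ [/\ p <= x.1, p <= y.1 & y.2 = x.2]).
apply: (@leq_card_fset_rel _ _ R) => [[i j]|[i j] [i2 j2] [i' j']].
  rewrite !inE /= mem_la => /andP[jc /eqP ek].
  have hr : weight a b (i, j) %% n < m by rewrite ek.
  have [ip|pi] := ltnP i p.
    have [j' e _] := vertex_theta S j (ltnW ip).
    exists (i, j'); last by split=> //; left.
    rewrite !inE /= mem_mu (mem_theta S ip _ e) // jc /=.
    by rewrite /weight /= e theta_mod // -ek.
  have jq : j < q by apply: (@mem_row i); rewrite ?mem_la.
  have [i' e [/(_ pi) pi' _]] := vertex_theta (stretched_tr S) i (ltnW jq).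
  have hr' : (b * j + a * i) %% n < m by rewrite addnC.
  exists (i', j); last by split; [rewrite /weight /= addnC e addnC | right].
  rewrite !inE /= mem_mu -(tame_conj t') (mem_theta (stretched_tr S) jq _ e) //.
  by rewrite (tame_conj t) jc /weight /= addnC e theta_mod // addnC -ek.
rewrite !inE /= => /andP[_ /eqP ek] /andP[_ /eqP ek2] [e h] [e2 h2].
have ww : weight a b (i, j) = weight a b (i2, j2).
  by rewrite -(@thetaK n m (weight a b (i, j))) -?e ?e2 ?thetaK // ?ek ?ek2.
case: h h2 => [[/= ip ei]|[/= pi pi' ej]] [[/= ip2 ei2]|[/= pi2 pi2' ej2]].
- move: ww; rewrite /weight /= -ei -ei2 => /addnI/eqP.
  by rewrite eqn_pmul2l // => /eqP ->.
- by move: pi2'; rewrite ei leqNgt ip.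
- by move: pi'; rewrite ei2 leqNgt ip2.
- move: ww; rewrite /weight /= -ej -ej2 => /addIn/eqP.
  by rewrite eqn_pmul2l // => /eqP ->.
Qed.

(** A box stands for the pair of its column and its row. In the [p] by [q] rectangle it stays put;
    with [q <= j] it keeps its column and follows the upper end of the row edge; with [p <= i] it
    keeps its row and follows the left end of the column edge. The common residue is at most [s]
    because the kept edge is tame. *)
Lemma dnat_leq :
  #|` [fset x in la | dnat a b n c l x]| <= #|` [fset x in mu | dnat a b m c' l' x]|.
Proof.
pose R (x y : nat * nat) := [\/ [/\ x.1 < p, x.2 < q & y = x],
  [/\ x.1 < p /\ q <= x.2, y.1 = x.1, q <= y.2, l' y.2 = l x.2 &
     a * l x.2 + b * y.2.+1 = theta n m (a * l x.2 + b * x.2.+1)] |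
  [/\ p <= x.1 /\ x.2 < q, p <= y.1, y.2 = x.2, c' y.1 = c x.1 &
     b * c x.1 + a * y.1 = theta n m (b * c x.1 + a * x.1)]].
have up i j : i < p -> dnat a b n c l (i, j) -> (a * l j + b * j.+1) %% n <= s.
  move=> ip; rewrite /dnat /= mulnS (addnC b) addnA => /eqP <-.
  exact: leq_trans (leq_addr _ _) (tame_col t ip).
have row_mod j : j < q -> (a * l' j + b * j + b) %% m = (a * l j + b * j + b) %% n.
  move=> jq; rewrite (addnC (a * l' j)) -(col_end_add (stretched_tr S) jq).
  rewrite theta_mod (addnC (b * j)) //.
  rewrite modnD_small (addnC (a * l j)) ?(leq_ltn_trans (tame_row t jq)) //.
apply: (@leq_card_fset_rel _ _ R) => [[i j]|[i j] [i2 j2] [i' j']].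
  rewrite !inE /= mem_la => /andP[jc hd].
  have [ip|pi] := ltnP i p; have [jq|qj] := ltnP j q.
  - exists (i, j); last exact: Or31.
    rewrite !inE /= mem_mu (ltn_trans jq (tame_c t' ip)) /dnat /=.
    by rewrite (col_end_mod S ip) (row_mod j jq).
  - have [j' [qj' lj' e]] := row_start_theta S qj (up i j ip hd).
    exists (i, j'); last by apply: Or32.
    rewrite !inE /= mem_mu -(tame_conj t') lj' (tame_conj t) jc /dnat /=.
    rewrite (col_end_mod S ip) lj' -addnA (addnC _ b) -mulnS e theta_mod.
      by move: hd; rewrite /dnat /= -addnA (addnC _ b) -mulnS.
    exact: leq_ltn_trans (up i j ip hd) s_m.
  - have hr : (b * c i + a * i) %% n <= s.
      move: hd; rewrite /dnat /= addnC => /eqP ->; rewrite (addnC (a * _)).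
      by rewrite modnD_small ?(tame_row t jq) // (leq_ltn_trans (tame_row t jq)).
    have [i' [pi' ci' e]] := row_end_theta (stretched_tr S) pi hr.
    exists (i', j); last by apply: Or33.
    rewrite !inE /= mem_mu ci' jc /dnat /= ci' addnC e theta_mod ?(row_mod j jq).
      by rewrite addnC.
    exact: leq_ltn_trans hr s_m.
  - by move: qj; rewrite leqNgt (@mem_row i j pi) ?mem_la.
rewrite !inE /= => /andP[_ hd] /andP[_ hd2].
have small v : v %% n <= s -> v %% n < m by move=> h; apply: leq_ltn_trans h s_m.
have low k h : p <= k -> h < q -> dnat a b n c l (k, h) -> (b * c k + a * k) %% n <= s.
  move=> pk hq; rewrite /dnat /= addnC => /eqP ->; rewrite (addnC (a * _)).
  by rewrite modnD_small ?(tame_row t hq) // (leq_ltn_trans (tame_row t hq)).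
case=> [[/= ip jq [ei' ej']]|[/= [ip qj] ei' qj' lj' e]|[/= [pi jq] pi' ej' ci' e]];
case=> [[/= ip2 jq2 [ei2 ej2]]|[/= [ip2 qj2] ei2 qj2' lj2 e2]|[/= [pi2 jq2] pi2' ej2 ci2 e2]].
- by rewrite -ei' -ej' ei2 ej2.
- by move: qj2'; rewrite ej' leqNgt jq.
- by move: pi2'; rewrite ei' leqNgt ip.
- by move: qj'; rewrite ej2 leqNgt jq2.
- rewrite -ei' ei2; congr pair.
  have ww : a * l j + b * j.+1 = a * l j2 + b * j2.+1.
    rewrite -(@thetaK n m (a * l j + b * j.+1)) ?small ?(up i) //.
    rewrite -(@thetaK n m (a * l j2 + b * j2.+1)) ?small ?(up i2) //.
    by rewrite -e -e2 -lj' -lj2.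
  move: ww; rewrite -lj' -lj2 => /addnI/eqP; rewrite eqn_pmul2l // => /eqP[] //.
- by move: pi2'; rewrite ei' leqNgt ip.
- by move: pi'; rewrite ei2 leqNgt ip2.
- by move: pi'; rewrite ei2 leqNgt ip2.
- rewrite -ej' ej2; congr pair.
  have ww : b * c i + a * i = b * c i2 + a * i2.
    rewrite -(@thetaK n m (b * c i + a * i)) ?small ?(low i j) //.
    rewrite -(@thetaK n m (b * c i2 + a * i2)) ?small ?(low i2 j2) //.
    by rewrite -e -e2 -ci' -ci2.
  by move: ww; rewrite -ci' -ci2 => /addnI/eqP; rewrite eqn_pmul2l // => /eqP.
Qed.

Lemma unat_leq :
  #|` [fset x in la | unat a b n c l x]| <= #|` [fset x in mu | unat a b m c' l' x]|.
Proof.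
pose R (x y : nat * nat) := [\/ [/\ x.1 < p, x.2 < q & y = x] |
  [/\ x.1 < p /\ q <= x.2, y.1 = x.1, q <= y.2, l' y.2 = l x.2 &
     a * l x.2 + b * y.2 = theta n m (a * l x.2 + b * x.2)]].
have col_mod i : i < p -> (a * i + b * c' i + a) %% m = (a * i + b * c i + a) %% n.
  move=> ip; rewrite -(col_end_add S ip) theta_mod //.
  by rewrite modnD_small ?(leq_ltn_trans (tame_col t ip)).
have up i j : i < p -> unat a b n c l (i, j) -> (a * l j + b * j) %% n <= s.
  move=> ip /andP[_ /eqP /= <-].
  by rewrite modnD_small ?(tame_col t ip) // (leq_ltn_trans (tame_col t ip)).
apply: (@leq_card_fset_rel _ _ R) => [[i j]|[i j] [i2 j2] [i' j']].
  rewrite !inE /= mem_la => /andP[jc hu].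
  (* Otherwise [l j = i.+1] reduces the congruence to [b * (c i - j)] being 0 modulo [n], although
     it is positive and at most [b * q <= s < n]. *)
  have ip : i < p.
    rewrite ltnNge; apply/negP => pi.
    have jq : j < q by apply: (@mem_row i); rewrite ?mem_la.
    have cq : c i <= q by apply: leq_trans (tame_anti t pi) (tame_cp t).
    move: hu; rewrite /unat /= => /andP[/eqP -> ].
    rewrite -(subnKC (ltnW jc)) mulnDr mulnS.
    rewrite (_ : _ + a = a + a * i + b * j + b * (c i - j)); last by lia.
    rewrite -[X in _ == X %[mod _]]addn0 eqn_modDl mod0n modn_small.
      by rewrite muln_eq0 eqn0Ngt b_gt0 /= subn_eq0 leqNgt jc.
    have := tame_pq t; move: s_n.
    have : b * (c i - j) <= b * q by rewrite leq_mul2l (leq_trans (leq_subr _ _) cq) orbT.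
    by move=> *; lia.
  have [jq|qj] := ltnP j q.
  - exists (i, j); last by left.
    rewrite !inE /= mem_mu (ltn_trans jq (tame_c t' ip)).
    move: hu; rewrite /unat /= => /andP[/eqP lj hu].
    have lp : l j = p by apply/eqP; rewrite eqn_leq {1}lj ip ltnW // (tame_l t jq).
    have xs : b * j + a * p <= s.
      apply: leq_trans (tame_pq t); rewrite addnC leq_add2l.
      by rewrite leq_mul2l (ltnW jq) orbT.
    have lp' : l' j = p.
      have := str_row S jq; rewrite lp theta_small ?(leq_ltn_trans xs) //.
      by move/addnI/eqP; rewrite eqn_pmul2l // => /eqP.
    rewrite lp' -lp lj eqxx /= (col_mod i ip) (eqP hu) -lj lp addnC.
    by rewrite !modn_small ?(leq_ltn_trans xs).
  - have [j' [qj' lj' e]] := row_end_theta S qj (up i j ip hu).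
    exists (i, j'); last by right.
    rewrite !inE /= mem_mu -(tame_conj t') lj' (tame_conj t) jc /unat /=.
    rewrite (col_mod i ip) lj' e theta_mod //.
    exact: leq_ltn_trans (up i j ip hu) s_m.
rewrite !inE /= => /andP[_ hd] /andP[_ hd2].
have small v : v %% n <= s -> v %% n < m by move=> h; apply: leq_ltn_trans h s_m.
case=> [[/= ip jq [ei' ej']]|[/= [ip qj] ei' qj' lj' e]];
case=> [[/= ip2 jq2 [ei2 ej2]]|[/= [ip2 qj2] ei2 qj2' lj2 e2]].
- by rewrite -ei' -ej' ei2 ej2.
- by move: qj2'; rewrite ej' leqNgt jq.
- by move: qj'; rewrite ej2 leqNgt jq2.
- rewrite -ei' ei2; congr pair.
  have ww : a * l j + b * j = a * l j2 + b * j2.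
    rewrite -(@thetaK n m (a * l j + b * j)) ?small ?(up i) //.
    rewrite -(@thetaK n m (a * l j2 + b * j2)) ?small ?(up i2) //.
    by rewrite -e -e2 -lj' -lj2.
  by move: ww; rewrite -lj' -lj2 => /addnI/eqP; rewrite eqn_pmul2l // => /eqP.
Qed.

End Counting.

(** * Recurrence for the class sizes *)

Lemma progression_shift b m u d h : d + b < m ->
  \sum_(j < h) ((u + b * j) %% m == d) + (u %% m == d + b) =
  \sum_(j < h) ((u + b * j) %% m == d + b) + ((u + b * h) %% m == d + b).
Proof.
move=> db; elim: h => [|h IH]; first by rewrite !big_ord0 muln0 addn0.
(* A term of residue [d] is followed by one of residue [d + b], without wrapping since [d + b < m],
   and conversely; only the two ends stay unmatched. *)
rewrite !big_ord_recr /= addnAC IH; congr (_ + _).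
rewrite mulnS (addnC b) addnA; congr nat_of_bool.
set v := u + b * h; apply/eqP/eqP => [e|e].
  by rewrite modnD_small e.
have m0 : 0 < m by apply: leq_ltn_trans db.
have dm : d < m by apply: leq_ltn_trans db; rewrite leq_addr.
apply/eqP; rewrite -[X in _ == X](modn_small dm) -(eqn_modDr b) e modn_small //.
Qed.

(** A column left of [p] starts at weight at most [s - a] and ends at residue at most [s - a], both
    below [d + b], so [progression_shift] has no boundary terms. *)
Lemma cols_shift a b s m c l p q X d : tame a b s m c l p q ->
  d + b < m -> s < d + b + a ->
  \sum_(i < X) \sum_(j < c i) ((i < p) && ((a * i + b * j) %% m == d)) =
  \sum_(i < X) \sum_(j < c i) ((i < p) && ((a * i + b * j) %% m == d + b)).
Proof.
move=> t dbm sdb; apply: eq_bigr => i _.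
have [ip|_] /= := ltnP i p; last by rewrite !big1.
have ai : a * i + a <= s.
  apply: leq_trans (tame_pq t); rewrite addnC -mulnS.
  by apply: leq_trans (leq_addr _ _); rewrite leq_mul2l ip orbT.
have := progression_shift (a * i) (c i) dbm.
rewrite [(_ + _) %% m == d + b in X in _ = _ + X](_ : _ = false); last first.
  by apply/eqP => e; have := tame_col t ip; rewrite e leqNgt sdb.
rewrite [a * i %% m == _](_ : _ = false) ?addn0 //.
apply/eqP; rewrite modn_small => [e|].
  by move: ai; rewrite e leqNgt sdb.
by apply: leq_ltn_trans (leq_addr a _) (leq_ltn_trans ai (tame_s t)).
Qed.

Section Recurrence.
Variables (a b s m p q : nat) (mu : {fset nat * nat}).
Hypothesis mu_young : young mu.
Hypothesis t : tame a b s m (ccol mu) (lrow mu) p q.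
Hypothesis ab_s : a * b <= s.

Let cls d := #|` [fset x in mu | weight a b x %% m == d]|.
Let C d := \sum_(x <- mu) ((x.1 < p) && (weight a b x %% m == d)).
Let R d := \sum_(x <- mu) ((x.2 < q) && (weight a b x %% m == d)).

(** A box in both arms weighs at most [s - a - b], too little for class [d]; every other box lies in
    exactly one arm. *)
Lemma class_arms d : s < d + a + b -> cls d = C d + R d.
Proof.
move=> hd; rewrite /cls (card_fset_sum mu (fun x => weight a b x %% m == d)) -big_split /=.
rewrite !big_seq; apply: eq_bigr => -[i j] xmu /=.
have [ip|pi] := ltnP i p; have [jq|qj] //= := ltnP j q; rewrite ?addn0 //.
- rewrite [_ == d](_ : _ = false) //.
  have lt_s : weight a b (i, j) + a + b <= s.
    rewrite /weight /=; apply: leq_trans (tame_pq t).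
    rewrite (_ : _ + b = a * i.+1 + b * j.+1); last by rewrite !mulnS; lia.
    by apply: leq_add; rewrite leq_mul2l ?ip ?jq orbT.
  apply/eqP; rewrite modn_small; last first.
    apply: leq_ltn_trans (tame_s t); apply: leq_trans lt_s.
    by rewrite -addnA leq_addr.
  by move=> e; move: lt_s; rewrite e leqNgt hd.
- move: xmu; rewrite (mem_ccol mu_young) => jc.
  have := leq_trans jc (leq_trans (tame_anti t pi) (tame_cp t)).
  by rewrite ltnNge qj.
Qed.

(* Column by column left of [p], the classes [k] and [k - b], and [k - a] and
   [k - a - b], have equal sizes, as no column starts or ends there. *)
Lemma class_recurrence k : s < k -> k < m ->
  cls k + cls (k - a - b) = cls (k - a) + cls (k - b).
Proof.
move=> sk km.
have [a0 b0] := (tame_a t, tame_b t).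
(* Since [(a - 1) * (b - 1) >= 0], one has [a + b <= a * b + 1 <= s + 1 <= k]. *)
have abk : a + b <= k.
  apply: leq_trans sk; apply: (@leq_trans (a * b).+1); last by rewrite ltnS.
  rewrite -(prednK a0) -(prednK b0) mulSn mulnS !addSn addnS !ltnS addnCA addnA.
  exact: leq_addr.
have eC d : d + b < m -> s < d + b + a -> C d = C (d + b).
  move=> h1 h2; rewrite /C.
  rewrite (sum_cols mu_young (fun i j => (i < p) && (weight a b (i, j) %% m == d)) (leqnn _)).
  rewrite (sum_cols mu_young (fun i j => (i < p) && (weight a b (i, j) %% m == d + b)) (leqnn _)).
  exact: cols_shift t _ _.
have eR d : d + a < m -> s < d + a + b -> R d = R (d + a).
  move=> h1 h2; rewrite /R.
  rewrite (sum_rows mu_young (fun i j => (j < q) && (weight a b (i, j) %% m == d)) (leqnn _)).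
  rewrite (sum_rows mu_young (fun i j => (j < q) && (weight a b (i, j) %% m == d + a)) (leqnn _)).
  rewrite /weight /=.
  have := cols_shift #|` mu| (tame_tr t) h1 h2.
  have comm d' : \sum_(i < #|` mu|) \sum_(j < lrow mu i) ((i < q) && ((b * i + a * j) %% m == d'))
     = \sum_(i < #|` mu|) \sum_(j < lrow mu i) ((i < q) && ((a * j + b * i) %% m == d')).
    by apply: eq_bigr => i _; apply: eq_bigr => j _; rewrite addnC.
  by rewrite !comm.
have kab : k - a - b + b = k - a by lia.
have kba : k - a - b + a = k - b by lia.
have ka : k - a + a = k by lia.
have kb : k - b + b = k by lia.
rewrite !class_arms; try lia.
have := eC (k - b); rewrite kb => -> //; last by lia.
have := eC (k - a - b); rewrite kab => ->; [|lia..].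
have := eR (k - a); rewrite ka => -> //; last by lia.
have := eR (k - a - b); rewrite kba => ->; [|lia..].
lia.
Qed.

Lemma class_const r : (forall k, k <= s -> cls k = r) -> forall k, k < m -> cls k = r.
Proof.
move=> hs; elim/ltn_ind => k IH km.
have [/hs //|sk] := leqP k s.
have [a0 b0] := (tame_a t, tame_b t).
have := class_recurrence sk km.
by rewrite (IH (k - a - b)) ?(IH (k - a)) ?(IH (k - b)); [move/addIn | lia..].
Qed.

End Recurrence.

(** * Stretching a balanced diagram *)

Definition natB (r a b n : nat) (la : {fset nat * nat}) : Prop :=
  [/\ young la, #|` la| = r * n &
    forall k, k < n -> #|` [fset x in la | weight a b x %% n == k]| = r].

Lemma sum_classes a b n (la : {fset nat * nat}) (G : nat -> nat) : 0 < n ->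
  \sum_(x <- la) G (weight a b x %% n) =
  \sum_(k < n) #|` [fset x in la | weight a b x %% n == k]| * G k.
Proof.
move=> n0.
under [RHS]eq_bigr => k _.
  rewrite (card_fset_sum la (fun x => weight a b x %% n == k)) big_distrl /=.
over.
rewrite exchange_big /=; apply: eq_bigr => x _.
rewrite (bigD1 (Ordinal (ltn_pmod (weight a b x) n0))) //= eqxx mul1n big1 ?addn0 //.
by move=> k /eqP kx; case: eqP => // e; case: kx; apply: val_inj.
Qed.

(** * Existence of an addable box of weight at most [s] *)

Definition is_corner (a b s : nat) (la : {fset nat * nat}) (x : nat * nat) : bool :=
  [&& weight a b x <= s, x \notin la, (x.1 == 0) || ((x.1.-1, x.2) \in la)
    & (x.2 == 0) || ((x.1, x.2.-1) \in la)].

(* The choice depends only on the boxes of weight at most [s], so a diagram and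
   its stretched version have the same corner. *)
Definition corner (a b s : nat) (la : {fset nat * nat}) : nat * nat :=
  if [pick y : 'I_s.+1 * 'I_s.+1 | is_corner a b s la (val y.1, val y.2)] is Some y
  then (val y.1, val y.2) else (0, 0).

(** A missing box of least weight is addable, as its left and lower neighbours weigh less.
    Positivity of [a] and [b] confines the search to coordinates up to [s]. *)
Lemma cornerP a b s la x : 0 < a -> 0 < b -> x \notin la -> weight a b x <= s ->
  is_corner a b s la (corner a b s la).
Proof.
move=> a0 b0 xla xs.
have [x1 x2] : x.1 < s.+1 /\ x.2 < s.+1.
  rewrite !ltnS; split; apply: leq_trans xs.
    by apply: leq_trans (leq_addr _ _); rewrite leq_pmull.
  by apply: leq_trans (leq_addl _ _); rewrite leq_pmull.
have wx : [exists y : 'I_s.+1 * 'I_s.+1,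
    ((val y.1, val y.2) \notin la) && (weight a b (val y.1, val y.2) == weight a b x)].
  by apply/existsP; exists (Ordinal x1, Ordinal x2); rewrite /= -surjective_pairing xla eqxx.
have ex : exists w, [exists y : 'I_s.+1 * 'I_s.+1,
    ((val y.1, val y.2) \notin la) && (weight a b (val y.1, val y.2) == w)].
  by exists (weight a b x).
case: (ex_minnP ex) => w /existsP[[y1 y2] /= /andP[yla /eqP yw]] minw.
have low z1 z2 : weight a b (z1, z2) < w -> z1 <= s -> z2 <= s -> (z1, z2) \in la.
  move=> zw z1s z2s; apply: contraLR zw => zla; rewrite -leqNgt; apply: minw.
  by apply/existsP; exists (Ordinal (z1s : z1 < s.+1), Ordinal (z2s : z2 < s.+1)); rewrite /= zla eqxx.
have ws : w <= s := leq_trans (minw _ wx) xs.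
have c : is_corner a b s la (val y1, val y2).
  apply/and4P; split=> //=; first by rewrite yw.
    case: (val y1) (ltn_ord y1) yw => [//|k] /= ks yw; apply: low => //.
    - by rewrite -yw /weight /= ltn_add2r ltn_pmul2l.
    - exact: ltnW.
    - by rewrite -ltnS.
  case: (val y2) (ltn_ord y2) yw => [//|k] /= ks yw; apply: low => //.
  - by rewrite -yw /weight /= ltn_add2l ltn_pmul2l.
  - by rewrite -ltnS.
  - exact: ltnW.
rewrite /corner; case: pickP => [y //|/(_ (y1, y2))].
by rewrite c.
Qed.

Lemma natB_corner r a b n la : 0 < a -> 0 < b -> r * a * b < n -> natB r a b n la ->
  is_corner a b (r * a * b) la (corner a b (r * a * b) la).
Proof.
move=> a0 b0 sn [yla _ bal].
(* For [t] from 0 to [r] these boxes all have weight [r * a * b < n], but that residue class has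
   only [r] boxes in the diagram. *)
pose f t := (t * b, (r - t) * a).
have finj : injective f by move=> t t' [/eqP]; rewrite eqn_pmul2r // => /eqP.
have wf t : t <= r -> weight a b (f t) = r * a * b.
  move=> tr; rewrite /weight /= -[in RHS](subnKC tr) !mulnDl; congr (_ + _).
    by rewrite mulnCA mulnA.
  by rewrite mulnC.
have [/allP h|] := boolP (all (fun t => f t \in la) (iota 0 r.+1)); last first.
  case/allPn => t; rewrite mem_iota add0n ltnS => /= tr ft.
  by apply: cornerP ft _; rewrite ?wf.
suff : r.+1 <= r by rewrite ltnn.
rewrite -{2}(bal _ sn).
have cardf m : #|` [fset f t | t in iota 0 m]| = m.
  by rewrite card_imfset //= undup_id ?iota_uniq ?size_iota.
rewrite -[X in X <= _]cardf.
apply: fsubset_leq_card; apply/fsubsetP => _ /imfsetP[t /= ht ->].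
have {}ht : t \in iota 0 r.+1 := ht.
rewrite !inE /= h // wf ?modn_small ?eqxx //.
by move: ht; rewrite mem_iota.
Qed.

Lemma natB_rows r a b n la (G : nat -> nat) X : 0 < n -> natB r a b n la -> #|` la| <= X ->
  \sum_(j < X) \sum_(i < lrow la j) G ((a * i + b * j) %% n) = r * \sum_(k < n) G k.
Proof.
move=> n0 [yla _ bal] hX.
rewrite -(sum_rows yla (fun i j => G (weight a b (i, j) %% n)) hX).
transitivity (\sum_(x <- la) G (weight a b x %% n)); first by [].
rewrite (sum_classes a b la G n0) big_distrr /=; apply: eq_bigr => k _.
by rewrite bal.
Qed.

Lemma natB_cols r a b n la (G : nat -> nat) X : 0 < n -> natB r a b n la -> #|` la| <= X ->
  \sum_(i < X) \sum_(j < ccol la i) G ((b * j + a * i) %% n) = r * \sum_(k < n) G k.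
Proof.
move=> n0 B hX; have [yla _ _] := B.
rewrite -(natB_rows G n0 B hX).
rewrite -(sum_rows yla (fun i j => G (weight a b (i, j) %% n)) hX).
rewrite (sum_cols yla (fun i j => G (weight a b (i, j) %% n)) hX).
by apply: eq_bigr => i _; apply: eq_bigr => j _; rewrite /weight addnC.
Qed.

(** The edge bounds come from [rows_tame], applied to the rows and, with the axes exchanged, to the
    columns. *)
Lemma natB_tame r a b n la (x := corner a b (r * a * b) la) : 0 < a -> 0 < b ->
  r * a * b < n -> natB r a b n la ->
  tame a b (r * a * b) n (ccol la) (lrow la) x.1 x.2.
Proof.
move=> a0 b0 sn B; have n0 : 0 < n by apply: leq_ltn_trans sn.
have [yla _ _] := B.
have := natB_corner a0 b0 sn B; rewrite -/x; case: x => p q /and4P[/= ws nla cp cq].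
have mono i j i' j' : i' <= i -> j' <= j -> (i, j) \in la -> (i', j') \in la.
  by move=> h1 h2 h; apply: yla h _ _.
have hp i : i < p -> q < ccol la i.
  move=> ip; rewrite -mem_ccol //; case: p cp ip {ws nla cq} => // p /= cp ip.
  exact: mono _ _ cp.
have hq j : j < q -> p < lrow la j.
  move=> jq; rewrite -mem_lrow //; case: q cq jq {ws nla cp hp} => // q /= cq jq.
  exact: mono _ _ cq.
have lq : lrow la q <= p by rewrite leqNgt -mem_lrow.
have cp' : ccol la p <= q by rewrite leqNgt -mem_ccol.
pose X := #|` la| + p + q.
have XX : #|` la| <= X by rewrite /X; lia.
split=> //.
- by move=> i j; rewrite -mem_lrow // mem_ccol.
- move=> i ip; rewrite (addnC (a * i)).
  apply: (@rows_tame b a n r (r * a * b) X p (ccol la)) => //.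
  + by move=> k; rewrite leqNgt -mem_ccol //; apply/negP => /(mono _ _ k _ (leqnSn _) (leqnn _));
      rewrite mem_ccol // ltnn.
  + by rewrite ccol_bound.
  + by rewrite /X; lia.
  + apply: leq_trans ws; rewrite /weight addnC leq_add2l leq_mul2l cp' orbT //.
  + by move=> G; apply: natB_cols.
- move=> j jq; rewrite (addnC (b * j)).
  apply: (@rows_tame a b n r (r * a * b) X q (lrow la)) => //.
  + by move=> k; rewrite leqNgt -mem_lrow //; apply/negP => /(mono _ _ _ k (leqnn _) (leqnSn _));
      rewrite mem_lrow // ltnn.
  + by rewrite lrow_bound.
  + by rewrite /X; lia.
  + apply: leq_trans ws; rewrite /weight leq_add2r leq_mul2l lq orbT //.
  + by move=> G; apply: natB_rows.
Qed.

Lemma eq_from_ltn x y : (forall k, (k < x) = (k < y)) -> x = y.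
Proof.
move=> E; apply/eqP; rewrite eqn_leq; apply/andP; split; rewrite leqNgt.
  by rewrite E ltnn.
by rewrite -E ltnn.
Qed.

(** * The stretched diagram, assembled from its two arms *)

Definition arms (p q : nat) (c l : nat -> nat) : {fset nat * nat} :=
  let X := p + q + \sum_(i < p) c i + \sum_(j < q) l j in
  [fset x in [seq (i, j) | i <- iota 0 X, j <- iota 0 X] |
    (x.1 < p) && (x.2 < c x.1) || (x.2 < q) && (x.1 < l x.2)].

Lemma in_arms p q c l i j :
  ((i, j) \in arms p q c l) = (i < p) && (j < c i) || (j < q) && (i < l j).
Proof.
rewrite !inE /=; apply: andb_idl => h; apply/allpairsP; exists (i, j).
rewrite !mem_iota /= !add0n; case/orP: h => /andP[h1 h2]; split=> //.
- by rewrite -!addnA (leq_trans h1) ?leq_addr.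
- apply: (leq_trans h2); rewrite (bigD1 (Ordinal h1)) //= [_ + (c i + _)]addnC -!addnA.
  by rewrite leq_addr.
- apply: (leq_trans h2); rewrite [X in _ <= _ + X](bigD1 (Ordinal h1)) //= addnCA.
  by rewrite leq_addr.
- by rewrite -!addnA addnCA (leq_trans h1) ?leq_addr.
Qed.

(** Columns left of the corner and rows below it determine the diagram, since no box lies weakly
    beyond the corner in both directions. *)
Definition stretch (a b s n m : nat) (la : {fset nat * nat}) : {fset nat * nat} :=
  let x := corner a b s la in
  arms x.1 x.2 (fun i => reach b n m (a * i) (a * i + b * ccol la i))
               (fun j => reach a n m (b * j) (b * j + a * lrow la j)).

Lemma arms_young p q (c l : nat -> nat) :
  (forall i, i < p -> q < c i) -> (forall j, j < q -> p < l j) ->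
  (forall i, i.+1 < p -> c i.+1 <= c i) -> (forall j, j.+1 < q -> l j.+1 <= l j) ->
  young (arms p q c l).
Proof.
have anti (P : nat) (h : nat -> nat) : (forall i, i.+1 < P -> h i.+1 <= h i) ->
    forall i i', i' <= i -> i < P -> h i <= h i'.
  move=> hh; elim=> [|i IH] i'; first by rewrite leqn0 => /eqP ->.
  rewrite leq_eqVlt => /orP[/eqP -> //|]; rewrite ltnS => ii' iP.
  by apply: leq_trans (hh _ iP) (IH _ ii' (ltnW iP)).
move=> cq lp /anti hc /anti hl i j i' j' h ii' jj'; move: h; rewrite !in_arms.
case/orP => /andP[h1 h2].
  by rewrite (leq_ltn_trans ii' h1) (leq_trans (leq_ltn_trans jj' h2)) ?hc.
apply/orP; right.
by rewrite (leq_ltn_trans jj' h1) (leq_trans (leq_ltn_trans ii' h2)) ?hl.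
Qed.

Lemma theta_geq n m u v : 0 < n -> u <= v -> u <= m -> u <= theta n m v.
Proof.
move=> n0 uv um; have [/theta_small ->//|h] := ltnP v n.
exact: leq_trans um (theta_large _ n0 h).
Qed.

Section Stretch.
Variables (a b s n m p q : nat) (c l : nat -> nat).
Hypothesis t : tame a b s n c l p q.
Hypothesis s_m : s < m.
Hypothesis nm : n = m %[mod b].

Let z i := reach b n m (a * i) (a * i + b * c i).

Let n_gt0 : 0 < n. Proof. exact: leq_ltn_trans (tame_s t). Qed.

Lemma stretch_colE i : i < p -> a * i + b * z i = theta n m (a * i + b * c i).
Proof.
move=> ip; apply: reachE nm erefl _; apply: theta_geq; rewrite ?leq_addr //.
apply: leq_trans (ltnW s_m); apply: leq_trans (tame_pq t).
by apply: leq_trans (leq_addr _ _); rewrite leq_mul2l (ltnW ip) orbT.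
Qed.

Lemma stretch_col_gt i : i < p -> q < z i.
Proof.
move=> ip; have b0 := tame_b t.
have <- : (a * i + b * q < a * i + b * z i) = (q < z i) by rewrite ltn_add2l ltn_pmul2l.
rewrite stretch_colE //; apply: theta_geq => //.
  by rewrite ltn_add2l ltn_pmul2l // (tame_c t ip).
apply: leq_ltn_trans s_m; apply: leq_trans (tame_pq t).
by rewrite leq_add2r leq_mul2l (ltnW ip) orbT.
Qed.

(** Heights decrease when the end of column [i.+1] weighs at most as much as the right end of the
    top edge of column [i]; [theta] preserves this comparison. *)
Lemma stretch_col_anti i : i.+1 < p -> z i.+1 <= z i.
Proof.
move=> ip; have b0 := tame_b t; have ip' := ltnW ip.
have <- : (a * i.+1 + b * z i.+1 <= a * i.+1 + b * z i) = (z i.+1 <= z i).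
  by rewrite leq_add2l leq_pmul2l.
have res k : k < p -> (a * k + b * c k) %% n < m.
  by move=> kp; apply: leq_ltn_trans (leq_trans (leq_addr _ _) (tame_col t kp)) s_m.
have -> : a * i.+1 + b * z i = theta n m (a * i + b * c i) + a.
  by rewrite -stretch_colE // mulnS -addnA addnC.
rewrite (stretch_colE ip) -theta_add ?(leq_ltn_trans (tame_col t ip') (tame_s t)) //.
rewrite theta_leq ?res //.
  by rewrite mulnSr [X in _ <= X]addnAC leq_add2l leq_mul2l (tame_anti t (leqnSn i)) orbT.
by rewrite modnD_small ?(leq_ltn_trans (tame_col t ip')) // (tame_s t).
Qed.

End Stretch.

(** The arms do not disturb each other: in a column left of [p], the boxes from rows below [q]
    already lie under its prescribed height, which exceeds [q]; likewise for rows. *)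
Lemma stretched_arms a b s n m c l p q (z := fun i => reach b n m (a * i) (a * i + b * c i))
    (x := fun j => reach a n m (b * j) (b * j + a * l j)) (mu := arms p q z x) :
  tame a b s n c l p q -> s < m -> n = m %[mod a * b] ->
  young mu /\ stretched a b s n m c l (ccol mu) (lrow mu) p q.
Proof.
move=> t s_m nm.
have nma : n = m %[mod a] := eqn_modW (dvdn_mulr b (dvdnn a)) nm.
have nmb : n = m %[mod b] := eqn_modW (dvdn_mull a (dvdnn b)) nm.
have zE i : i < p -> a * i + b * z i = theta n m (a * i + b * c i) :=
  @stretch_colE _ _ _ _ _ _ _ _ _ t s_m nmb i.
have xE j : j < q -> b * j + a * x j = theta n m (b * j + a * l j) :=
  @stretch_colE _ _ _ _ _ _ _ _ _ (tame_tr t) s_m nma j.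
have zq i : i < p -> q < z i := @stretch_col_gt _ _ _ _ _ _ _ _ _ t s_m nmb i.
have xp j : j < q -> p < x j := @stretch_col_gt _ _ _ _ _ _ _ _ _ (tame_tr t) s_m nma j.
have y : young mu.
  apply: arms_young => //; first exact: stretch_col_anti t s_m nmb.
  exact: stretch_col_anti (tame_tr t) s_m nma.
have col i : i < p -> ccol mu i = z i.
  move=> ip; have E j : (j < ccol mu i) = (j < z i).
    rewrite -mem_ccol // in_arms ip /=; apply: orb_idr => /andP[jq _].
    exact: ltn_trans jq (zq i ip).
  exact: eq_from_ltn E.
have row j : j < q -> lrow mu j = x j.
  move=> jq; have E i : (i < lrow mu j) = (i < x j).
    rewrite -mem_lrow // in_arms jq /=; apply: orb_idl => /andP[ip _].
    exact: ltn_trans ip (xp j jq).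
  exact: eq_from_ltn E.
have res k u : k + u <= s -> k < m.
  by move=> h; apply: leq_ltn_trans (leq_trans (leq_addr _ _) h) s_m.
split=> //; split=> //; last 2 first.
- by move=> i ip; rewrite col // zE.
- by move=> j jq; rewrite row // xE.
split=> //; rewrite ?(tame_a t) ?(tame_b t) ?(tame_pq t) //.
- by move=> i j; rewrite -mem_lrow // mem_ccol.
- by rewrite leqNgt -mem_ccol // in_arms !ltnn.
- by rewrite leqNgt -mem_lrow // in_arms !ltnn.
- by move=> i ip; rewrite col // zq.
- by move=> j jq; rewrite row // xp.
- move=> i ip; rewrite col // zE // theta_mod ?(tame_col t ip) //.
  exact: res (tame_col t ip).
- move=> j jq; rewrite row // xE // theta_mod ?(tame_row t jq) //.
  exact: res (tame_row t jq).
Qed.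

(** Weights up to [s] are fixed by [theta], so both diagrams agree there and the corner can be
    recovered after stretching. *)
Lemma mem_small a b s n m c l c' l' p q i j :
  stretched a b s n m c l c' l' p q -> a * i + b * j <= s -> (j < c i) = (j < c' i).
Proof.
move=> S h; have t := str_src S; have t' := str_tgt S.
have small : a * i + b * j < n by apply: leq_ltn_trans h (tame_s t).
have res : (a * i + b * j) %% n < m by rewrite modn_small // (leq_ltn_trans h (tame_s t')).
have [ip|pi] := ltnP i p.
  by rewrite (@mem_theta _ _ _ _ _ _ _ _ _ _ _ S i j j ip res) // theta_small.
have [jq|qj] := ltnP j q.
  rewrite -(tame_conj t) -(tame_conj t') (@mem_theta _ _ _ _ _ _ _ _ _ _ _ (stretched_tr S) j i i jq) //.
    by rewrite addnC.
  by rewrite theta_small // addnC.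
have F c0 l0 n0 : tame a b s n0 c0 l0 p q -> (j < c0 i) = false.
  move=> t0; apply/negbTE; rewrite -leqNgt.
  exact: leq_trans (tame_anti t0 pi) (leq_trans (tame_cp t0) qj).
by rewrite (F _ _ _ t) (F _ _ _ t').
Qed.

Lemma corner_stretched a b s n m (la mu : {fset nat * nat}) p q :
  young la -> young mu ->
  stretched a b s n m (ccol la) (lrow la) (ccol mu) (lrow mu) p q ->
  corner a b s mu = corner a b s la.
Proof.
move=> yla ymu S.
have E i j : weight a b (i, j) <= s -> ((i, j) \in mu) = ((i, j) \in la).
  by move=> h; rewrite !mem_ccol // (mem_small S h).
rewrite /corner (@eq_pick _ _ (fun y => is_corner a b s la (val y.1, val y.2))) //.
move=> [y1 y2]; rewrite /is_corner /=; have [h|//] := boolP (weight a b _ <= s).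
have a0 := tame_a (str_src S); have b0 := tame_b (str_src S).
rewrite !E //; apply: leq_trans h; rewrite /weight /=.
  by rewrite leq_add2l leq_mul2l leq_pred orbT.
by rewrite leq_add2r leq_mul2l leq_pred orbT.
Qed.

Lemma natB_stretched r a b n m la (s := r * a * b) (mu := stretch a b s n m la)
    (x := corner a b s la) :
  0 < a -> 0 < b -> s < n -> s < m -> n = m %[mod a * b] -> natB r a b n la ->
  young mu /\ stretched a b s n m (ccol la) (lrow la) (ccol mu) (lrow mu) x.1 x.2.
Proof. by move=> a0 b0 sn sm nm B; apply: stretched_arms => //; apply: natB_tame. Qed.

(** Classes up to [s] keep size [r] by [class_leq] in both directions, [class_const] extends this to
    all classes, and summing them gives the number of boxes. Here [0 < r] yields [a * b <= s]. *)
Lemma natB_stretch r a b n m la (s := r * a * b) (mu := stretch a b s n m la) :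
  0 < r -> 0 < a -> 0 < b -> s < n -> s < m -> n = m %[mod a * b] ->
  natB r a b n la -> natB r a b m mu.
Proof.
move=> r0 a0 b0 sn sm nm B; have [yla _ bal] := B.
have [ymu S] := natB_stretched a0 b0 sn sm nm B.
have m0 : 0 < m by apply: leq_ltn_trans sm.
have classes : forall k, k < m -> #|` [fset x in mu | weight a b x %% m == k]| = r.
  apply: (class_const ymu (str_tgt S)).
    by rewrite /s -mulnA leq_pmull.
  move=> k ks; apply/eqP; rewrite -[X in _ == X](bal k (leq_ltn_trans ks sn)) eqn_leq; apply/andP; split.
    exact: (class_leq (stretched_sym S) (mem_ccol ymu) (mem_ccol yla) ks).
  exact: (class_leq S (mem_ccol yla) (mem_ccol ymu) ks).
split=> //.
have := sum_classes a b mu (fun=> 1) m0; rewrite sum1_size => ->.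
rewrite (eq_bigr (fun=> r)) => [|k _]; last by rewrite classes ?muln1.
by rewrite sum_nat_const card_ord mulnC.
Qed.

(** Stretching back starts from the same corner, and the inverse of [theta] returns each arm to its
    original length. *)
Lemma stretchK r a b n m la (s := r * a * b) :
  0 < a -> 0 < b -> s < n -> s < m -> n = m %[mod a * b] -> natB r a b n la ->
  stretch a b s m n (stretch a b s n m la) = la.
Proof.
move=> a0 b0 sn sm nm B; have [yla _ _] := B.
have [ymu S] := natB_stretched a0 b0 sn sm nm B.
have e := corner_stretched yla ymu S.
set mu := stretch a b s n m la in ymu S e *.
apply/fsetP => -[i j]; rewrite {1}/stretch in_arms /= -/s e.
move: S; case: (corner a b s la) => p q /= S; have t := str_src S.
have back u v w k n0 : 0 < v -> u + v * w = theta m n0 k -> reach v m n0 u k = w.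
  by move=> v0 h; rewrite /reach -h addKn mulKn.
have [ip|pi] /= := ltnP i p.
  rewrite (back _ _ (ccol la i)) ?(str_col (stretched_sym S) ip) //.
  rewrite mem_ccol //; apply: orb_idr => /andP[jq].
  by move: (tame_c t ip) => qc _; apply: ltn_trans jq qc.
have [jq|qj] /= := ltnP j q.
  rewrite (back _ _ (lrow la j)) ?(str_row (stretched_sym S) jq) //.
  by rewrite mem_lrow.
rewrite mem_ccol //; apply/esym/negbTE; rewrite -leqNgt.
exact: leq_trans (tame_anti t pi) (leq_trans (tame_cp t) qj).
Qed.

(** * From integers to natural numbers *)

Lemma modz_eq0_dvd (d x : int) : (x %% d == 0)%Z = (d %| x)%Z.
Proof. by apply/eqP/idP => /dvdz_mod0P. Qed.

Lemma eqz_mod0_nat (x : int) (u v n : nat) : x = (v%:Z - u%:Z)%R ->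
  (x %% n%:Z == 0)%Z = (u == v %[mod n]).
Proof.
move=> ->; rewrite modz_eq0_dvd -eqz_mod_dvd eq_sym.
by rewrite -[RHS]eqz_nat -!modz_nat.
Qed.

Lemma Bset_nat r (a b n : nat) la : Bset r a b n la <-> natB r a b n la.
Proof.
have E (k : nat) : [fset x in la | color a b n x == Posz k] =
           [fset x in la | weight a b x %% n == k].
  apply/fsetP => x; rewrite !inE; congr (_ && _).
  by rewrite /color /weight -!PoszM -PoszD modz_nat eqz_nat.
split=> [[y [sz bal]]|[y sz bal]].
  by split=> // k kn; rewrite -E bal.
by do 2 split=> //; move=> k kn; rewrite E bal.
Qed.

Lemma betti_nat (a b n : nat) la : betti a b n la =
  #|` [fset x in la | dnat a b n (ccol la) (lrow la) x]| +
  #|` [fset x in la | unat a b n (ccol la) (lrow la) x]|.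
Proof.
rewrite /betti; congr (_ + _); congr #|` _|; apply/fsetP => -[i j]; rewrite !inE; congr (_ && _).
  by apply: eqz_mod0_nat; rewrite /=; lia.
rewrite /unat andbC /=; congr (_ && _).
  by apply/eqP/eqP; lia.
by rewrite eq_sym; apply: eqz_mod0_nat; rewrite /=; lia.
Qed.

Lemma Bset_opp r (a b : int) n la : 0 < n -> Bset r a b n la -> Bset r (- a)%R (- b)%R n la.
Proof.
move=> n0 [y [sz bal]]; do 2 split=> //; move=> k kn.
(* Negating both coefficients turns class [k] into class [-k]; the outer reduction modulo [n] takes
   care of [k = 0]. *)
rewrite -[RHS](bal ((n - k) %% n) (ltn_pmod _ n0)); congr #|` _|.
apply/fsetP => x; rewrite !inE; congr (_ && _); rewrite /color.
set u := (a * _ + b * _)%R.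
have -> : ((- a)%R * (x.1)%:Z + (- b)%R * (x.2)%:Z = - u)%R.
  by rewrite !mulNr -opprD.
have {1}-> : Posz k = (k%:Z %% n%:Z)%Z by rewrite modz_nat modn_small.
rewrite -modz_nat !eqz_mod_dvd -rpredN -subzn ?(ltnW kn) //.
have -> : (- (- u - k%:Z) = u - (n%:Z - k%:Z) + n%:Z)%R by lia.
by rewrite rpredDr // dvdzz.
Qed.

Lemma betti_opp (a b : int) n la : betti (- a)%R (- b)%R n la = betti a b n la.
Proof.
have E l s i j : Defs.invariant (- a)%R (- b)%R n l s i j = Defs.invariant a b n l s i j.
  rewrite /Defs.invariant !mulNr -opprD.
  by rewrite !modz_eq0_dvd rpredN.
by congr (_ + _); congr #|` _|; apply/fsetP => x; rewrite !inE /d_inv /u_inv E.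
Qed.

Lemma stretch_bijection r (a b n : nat) (m := n + a * b) :
  0 < r -> 0 < a -> 0 < b -> r * a * b < n ->
  exists f g : {fset nat * nat} -> {fset nat * nat},
    [/\ forall la, natB r a b n la -> natB r a b m (f la),
        forall mu, natB r a b m mu -> natB r a b n (g mu),
        forall la, natB r a b n la -> g (f la) = la,
        forall mu, natB r a b m mu -> f (g mu) = mu &
        forall la, natB r a b n la -> betti a b m (f la) = betti a b n la].
Proof.
move=> r0 a0 b0 sn; have sm : r * a * b < m by apply: ltn_addr.
have nm : n = m %[mod a * b] by rewrite /m modnDr.
exists (stretch a b (r * a * b) n m), (stretch a b (r * a * b) m n); split=> la B.
- exact: natB_stretch.
- exact: natB_stretch.
- exact: stretchK B.
- exact: stretchK B.
have [yla _ _] := B; have [ymu S] := natB_stretched a0 b0 sn sm nm B.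
have [mla mmu] := (mem_ccol yla, mem_ccol ymu).
rewrite !betti_nat; congr (_ + _); apply/eqP; rewrite eqn_leq.
  by rewrite (dnat_leq S mla mmu) (dnat_leq (stretched_sym S) mmu mla).
by rewrite (unat_leq S mla mmu) (unat_leq (stretched_sym S) mmu mla).
Qed.

Local Open Scope ring_scope.

(* Since a*b > 0, the modulus n + ab is the natural number (n + |ab|)%N. *)
Theorem theorem1p2 (r : nat) (a b : int) :
  (0 < r)%N -> gcdz a b = 1 -> 0 < a * b ->
  forall n : nat, r%:Z * a * b < n%:Z ->
  exists (f g : {fset (nat * nat)} -> {fset (nat * nat)}),
    (forall la, Bset r a b n la -> Bset r a b (n + absz (a * b)%R)%N (f la)) /\
    (forall mu, Bset r a b (n + absz (a * b)%R)%N mu -> Bset r a b n (g mu)) /\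
    (forall la, Bset r a b n la -> g (f la) = la) /\
    (forall mu, Bset r a b (n + absz (a * b)%R)%N mu -> f (g mu) = mu) /\
    (forall la, Bset r a b n la ->
       betti a b (n + absz (a * b)%R)%N (f la) = betti a b n la).
Proof.
move=> r0 _ ab0 n rabn.
have [a0 b0] : a != 0 /\ b != 0.
  by move: (lt0r_neq0 ab0); rewrite mulf_eq0 negb_or => /andP.
have c0 : (0 < absz a)%N by rewrite absz_gt0.
have d0 : (0 < absz b)%N by rewrite absz_gt0.
have sn : (r * absz a * absz b < n)%N.
  by rewrite -ltz_nat -mulnA PoszM -abszM gtz0_abs // mulrA.
have [f [g [hf hg gf fg hb]]] := stretch_bijection r0 c0 d0 sn.
have n0 : (0 < n)%N by apply: leq_ltn_trans sn.
have m0 : (0 < n + absz a * absz b)%N by apply: ltn_addr.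
rewrite abszM.
suff [EB Eb] : (forall k la, (0 < k)%N ->
      (Bset r a b k la <-> natB r (absz a) (absz b) k la)) /\
    (forall k la, betti a b k la = betti (absz a) (absz b) k la).
  have [Bn Bm] := (fun la => EB n la n0, fun la => EB _ la m0).
  exists f, g; split; first by move=> la /Bn /hf /Bm.
  split; first by move=> mu /Bm /hg /Bn.
  split; first by move=> la /Bn /gf.
  by split=> [mu /Bm /fg|la /Bn /hb] //; rewrite !Eb.
(* As [a * b] is positive, both signs agree; if both are negative, negating both reduces to the
   positive case. *)
have [a_gt0|a_le0] := ltrP 0 a.
  have b_gt0 : 0 < b by rewrite -(pmulr_rgt0 _ a_gt0).
  have [ea eb] := (gtz0_abs a_gt0, gtz0_abs b_gt0).
  split=> k la; last by rewrite ea eb.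
  by move=> _; rewrite -{1}ea -{1}eb; apply: Bset_nat.
have a_lt0 : a < 0 by rewrite lt_neqAle a_le0 a0.
have b_lt0 : b < 0 by rewrite -(nmulr_rgt0 _ a_lt0).
have [ea eb] := (ltz0_abs a_lt0, ltz0_abs b_lt0).
split=> k la; last by rewrite ea eb betti_opp.
move=> k0; rewrite -Bset_nat ea eb; split; first exact: Bset_opp.
by move=> /(Bset_opp k0); rewrite !opprK.
Qed.
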